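(* Let $t$ be a positive integer, let $H$ be a graph with minimum degree $\delta(H)\ge 2t$, and let $G=L(H)$ be its line graph, with maximum degree $\Delta(G)=\Delta$ and order $n(G)$. Then the following statements hold for every integer $k$ with $2\le k\le 2t-1$. (a) If $n(G)\ge k^{\Delta-k+1}(\Delta^2+1)$, then $\mathrm{a}_k'(G)=k$ and $\mathrm{b}_{k-1}'(G)=k$. (b) If $n(G)\ge (k^{\Delta-k+1}+1)(\Delta^2+1)$, then $\mathrm{a}_k(G)=k$ and $\mathrm{b}_{k-1}(G)=k$.
   Context: Graphs are finite, simple and undirected. The line graph $L(H)$ of $H$ has the edges of $H$ as vertices, two of them being adjacent iff the corresponding edges share a vertex in $H$. For positive integers $a,b$, the $(a,b)$-biased Maker-Breaker domination game on a graph $G$ is played by Dominator and Staller, who move alternately; on each move Dominator selects $a$ unplayed vertices and Staller selects $b$ unplayed vertices (if fewer unplayed vertices remain than the player's bias, the player selects all remaining ones). Dominator wins if the vertices he selected during the game form a dominating set of $G$; otherwise Staller wins, equivalently, Staller wins iff she claims all vertices of the closed neighborhood of some vertex. In the D-game Dominator moves first; in the S-game Staller moves first. Let $W(G,a,b)\in\{D,S\}$ (resp. $W'(G,a,b)\in\{D,S\}$) denote the winner of the $(a,b)$-biased D-game (resp. S-game) under optimal play, with $D$ standing for Dominator and $S$ for Staller. For a positive integer $\ell$ the thresholds, with minima over positive integers and value $\infty$ if the minimum does not exist, are $\mathrm{a}_\ell(G)=\min\{a: W(G,a,\ell)=D\}$, $\mathrm{a}'_\ell(G)=\min\{a: W'(G,a,\ell)=D\}$,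 $\mathrm{b}_\ell(G)=\min\{b: W(G,\ell,b)=S\}$, $\mathrm{b}'_\ell(G)=\min\{b: W'(G,\ell,b)=S\}$. *)

(* Defs.v *)
From HB Require Import structures.
From mathcomp Require Import all_boot.
From mathcomp Require Import boolp.

Set Implicit Arguments.
Unset Strict Implicit.
Unset Printing Implicit Defensive.

Record sgraph := SGraph {
  vertex :> finType;
  adj : rel vertex;
  adj_sym : symmetric adj;
  adj_irr : irreflexive adj
}.

Definition degree (G : sgraph) (v : G) : nat := #|[set u | adj v u]|.

Definition max_degree (G : sgraph) : nat := \max_(v : G) degree v.

(* Every degree is below #|G|, so the default value #|G| only matters for the
   graph with no vertex, whose minimum degree is 0 by this convention. *)
Definition min_degree (G : sgraph) : nat := \big[minn/#|G|]_(v : G) degree v.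

Definition edge_set (H : sgraph) : {set {set H}} :=
  [set E : {set H} | [exists x, exists y, adj x y && (E == [set x; y])]].

Definition line_vertex (H : sgraph) : finType :=
  {E : {set H} | E \in edge_set H}.

Definition line_adj (H : sgraph) : rel (line_vertex H) :=
  fun E F => (E != F) && (val E :&: val F != set0).

Lemma line_adj_sym (H : sgraph) : symmetric (@line_adj H).
Proof. by move=> E F; rewrite /line_adj eq_sym setIC. Qed.

Lemma line_adj_irr (H : sgraph) : irreflexive (@line_adj H).
Proof. by move=> E; rewrite /line_adj eqxx. Qed.

Definition line_graph (H : sgraph) : sgraph :=
  SGraph (@line_adj_sym H) (@line_adj_irr H).

Definition dominating (G : sgraph) (A : {set G}) : bool :=
  [forall v, exists u in A, (u == v) || adj u v].

Inductive player := Dominator | Staller.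

Definition is_dominator (p : player) : bool :=
  if p is Dominator then true else false.
Definition player_of_bool (b : bool) : player :=
  if b then Dominator else Staller.
Lemma is_dominatorK : cancel is_dominator player_of_bool.
Proof. by case. Qed.
HB.instance Definition _ := Equality.copy player (can_type is_dominatorK).

(* X is a move of a player with bias c when the vertices of P have already been
   played: c unplayed vertices, or all of them if fewer remain. *)
Definition legal_move (G : sgraph) (c : nat) (P X : {set G}) : bool :=
  (X \subset ~: P) && (#|X| == minn c #|~: P|).

(* Backward induction: the winner under optimal play when p is to move, D and S
   are the vertices selected so far by Dominator and by Staller, and n more
   moves are made.  Once all vertices are played, the only legal move is set0,
   so extra moves do not change the outcome. *)
Fixpoint winner (G : sgraph) (a b n : nat) (p : player) (D S : {set G}) :
    player :=
  if n is n'.+1 then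
    match p with
    | Dominator =>
        if [exists X : {set G}, legal_move a (D :|: S) X &&
              (winner a b n' Staller (D :|: X) S == Dominator)]
        then Dominator else Staller
    | Staller =>
        if [exists X : {set G}, legal_move b (D :|: S) X &&
              (winner a b n' Dominator D (S :|: X) == Staller)]
        then Staller else Dominator
    end
  else if dominating D then Dominator else Staller.

(* For positive biases each move plays at least one vertex while some are
   unplayed, so the game is over after at most #|G| moves. *)
Definition W (G : sgraph) (a b : nat) : player :=
  winner a b #|G| Dominator (set0 : {set G}) set0.

Definition W' (G : sgraph) (a b : nat) : player :=
  winner a b #|G| Staller (set0 : {set G}) set0.

(* The least positive integer satisfying P; None stands for infinity. *)
Definition min_pos (P : pred nat) : option nat :=
  match pselect (exists n, (0 < n) && P n) with
  | left exP => Some (ex_minn exP)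
  | right _ => None
  end.

Definition a_thr (G : sgraph) (l : nat) : option nat :=
  min_pos (fun a => W G a l == Dominator).

Definition a'_thr (G : sgraph) (l : nat) : option nat :=
  min_pos (fun a => W' G a l == Dominator).

Definition b_thr (G : sgraph) (l : nat) : option nat :=
  min_pos (fun b => W G l b == Staller).

Definition b'_thr (G : sgraph) (l : nat) : option nat :=
  min_pos (fun b => W' G l b == Staller).

(* Main.v *)
Require Import Defs.
From mathcomp Require Import all_boot zify.

(* Dominator: orient the edges of H so that every vertex has at least t outgoing
   edges, and let A_x be the set of edges leaving x.  A single move of Staller,
   of size less than 2t, can swallow A_x for at most one x.  Dominator answers
   each edge e = (x -> y) of that move with a free edge at x if x needs one, or
   else, when Staller owns all edges at x, with a free edge of A_y.
   Staller: in a large set of vertices with pairwise disjoint closed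
   neighborhoods she plays a box game.  She adds a vertex to k boxes per move
   while Dominator destroys at most k-1 of them, so halting at a common level
   costs a factor k in the number of boxes, and she wins once some box misses at
   most k vertices. *)

Set Implicit Arguments.
Unset Strict Implicit.
Unset Printing Implicit Defensive.

(** * Finite sets and least positive integers *)

Lemma exists_superset_card (T : finType) (A B : {set T}) (n : nat) :
  A \subset B -> #|A| <= n <= #|B| ->
  exists C : {set T}, [/\ A \subset C, C \subset B & #|C| = n].
Proof.
move=> sAB; elim: n => [|n IHn] /andP[leA leB].
  by exists A; split=> //; apply/eqP; rewrite -leqn0.
have [ltA|] := ltnP #|A| n.+1; last by exists A; split=> //; lia.
have [|C [sAC sCB cC]] := IHn; first lia.
have /card_gt0P[x] : 0 < #|B :\: C| by rewrite cardsD (setIidPr sCB) cC; lia.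
rewrite inE => /andP[xC xB]; exists (x |: C); split.
- exact: subset_trans sAC (subsetUr _ _).
- by rewrite subUset sub1set xB.
- by rewrite cardsU1 xC cC.
Qed.

Lemma leq_card_bigcup (T U : finType) (A : {set T}) (F : T -> {set U}) :
  #|\bigcup_(x in A) F x| <= \sum_(x in A) #|F x|.
Proof.
elim/big_ind2: _ => [|m1 Y1 m2 Y2 h1 h2|//]; first by rewrite cards0.
by rewrite (leq_trans (leq_card_setU _ _)) ?leq_add.
Qed.

(** Merges one-element replies into a single move. Staller uses it to enter several boxes at once,
    Dominator to answer a whole move. *)
Lemma exists_small_bigcup (T U : finType) (A : {set T}) (B : {set U})
    (P : T -> {set U} -> Prop) :
  (forall x (Y Z : {set U}), Y \subset Z -> P x Y -> P x Z) ->
  (forall x, x \in A ->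
     exists Y : {set U}, [/\ Y \subset B, #|Y| <= 1 & P x Y]) ->
  exists Y : {set U}, [/\ Y \subset B, #|Y| <= #|A| &
    forall x, x \in A -> P x Y].
Proof.
move=> monoP exP.
have [|F FP] := @fin_all_exists T (fun=> {set U}) (fun x Y => x \in A ->
    [/\ Y \subset B, #|Y| <= 1 & P x Y]).
  move=> x; case xA: (x \in A); last by exists set0.
  by have [Y HY] := exP x xA; exists Y.
exists (\bigcup_(x in A) F x); split.
- by apply/bigcupsP => x /FP[].
- rewrite -[leqRHS]sum1_card; apply: leq_trans (leq_card_bigcup _ _) _.
  by apply: leq_sum => x /FP[].
- by move=> x xA; have [_ _] := FP x xA; apply: monoP; apply: bigcup_sup.
Qed.

Lemma min_posE (P : pred nat) (m : nat) :
  0 < m -> P m -> (forall i, 0 < i < m -> ~~ P i) -> min_pos P = Some m.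
Proof.
move=> m0 Pm minm; rewrite /min_pos; case: boolp.pselect => [exP|]; last first.
  by case; exists m; rewrite m0.
congr Some; case: ex_minnP => n /andP[n0 Pn] leP.
have := leP m; rewrite m0 Pm => /(_ isT) lenm.
apply/eqP; rewrite eqn_leq lenm leqNgt; apply/negP => ltnm.
by have := minm n; rewrite n0 ltnm Pn => /(_ isT).
Qed.

(** * Playing by an invariant *)

Section Game.
Variable G : sgraph.
Implicit Types D S P X : {set G}.

(** Moves have a prescribed size, so a reply that needs fewer vertices is padded with arbitrary
    unplayed ones. *)
Lemma legal_move_extend c P (X : {set G}) :
  X \subset ~: P -> #|X| <= c ->
  exists2 Y : {set G}, legal_move c P Y & X \subset Y.
Proof.
move=> sX cX.
have [|Y [sXY sY cY]] := @exists_superset_card _ X (~: P) (minn c #|~: P|) sX.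
  by rewrite leq_min cX geq_minr (subset_leq_card sX).
by exists Y => //; rewrite /legal_move sY cY eqxx.
Qed.

Lemma exists_legal_move c P : exists X, legal_move c P X.
Proof.
have [||X legX _] := @legal_move_extend c P set0; first exact: sub0set.
  by rewrite cards0.
by exists X.
Qed.

Lemma card_legal_move c P X : legal_move c P X -> #|X| <= c.
Proof. by case/andP=> _ /eqP->; apply: geq_minl. Qed.

Lemma unplayed_legal_move c P X n : 0 < c -> legal_move c P X ->
  #|~: P| <= n.+1 -> #|~: (P :|: X)| <= n.
Proof.
move=> c0 /andP[sX /eqP cX] le.
have -> : ~: (P :|: X) = ~: P :\: X by rewrite setCU setDE.
rewrite cardsD (setIidPr sX) cX; lia.
Qed.

(** With positive biases each move shrinks the unplayed set until it is empty, so the board is full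
    after [n] moves and the last condition on [I] decides. *)
Lemma staller_strategy a b (I : player -> {set G} -> {set G} -> Prop) :
  0 < a -> 0 < b ->
  (forall D S, I Staller D S ->
     exists2 X, legal_move b (D :|: S) X & I Dominator D (S :|: X)) ->
  (forall D S X, I Dominator D S -> legal_move a (D :|: S) X ->
     I Staller (D :|: X) S) ->
  (forall p D S, I p D S -> D :|: S = setT -> ~~ dominating D) ->
  forall n p D S, I p D S -> #|~: (D :|: S)| <= n ->
    winner a b n p D S = Staller.
Proof.
move=> a0 b0 stepS stepD final; elim=> [|n IHn] p D S Ip len.
  rewrite /= (negPf (final p D S Ip _)) //.
  by apply/eqP; rewrite eqEsubset subsetT -setCS setCT subset0 -cards_eq0 -leqn0.
case: p Ip => Ip /=.
  case: existsP => // -[X /andP[legX]]; rewrite IHn //; first exact: stepD.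
  by rewrite setUAC; apply: unplayed_legal_move legX len.
case: existsP => // -[]; have [X legX IX] := stepS _ _ Ip.
exists X; rewrite legX IHn //.
by rewrite setUA; apply: unplayed_legal_move legX len.
Qed.

Lemma dominator_strategy a b (I : player -> {set G} -> {set G} -> Prop) :
  0 < a -> 0 < b ->
  (forall D S, I Dominator D S ->
     exists2 X, legal_move a (D :|: S) X & I Staller (D :|: X) S) ->
  (forall D S X, I Staller D S -> legal_move b (D :|: S) X ->
     I Dominator D (S :|: X)) ->
  (forall p D S, I p D S -> D :|: S = setT -> dominating D) ->
  forall n p D S, I p D S -> #|~: (D :|: S)| <= n ->
    winner a b n p D S = Dominator.
Proof.
move=> a0 b0 stepD stepS final; elim=> [|n IHn] p D S Ip len.
  rewrite /= (final p D S Ip _) //.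
  by apply/eqP; rewrite eqEsubset subsetT -setCS setCT subset0 -cards_eq0 -leqn0.
case: p Ip => Ip /=.
  case: existsP => // -[]; have [X legX IX] := stepD _ _ Ip.
  exists X; rewrite legX IHn //.
  by rewrite setUAC; apply: unplayed_legal_move legX len.
case: existsP => // -[X /andP[legX]]; rewrite IHn //; first exact: stepS.
by rewrite setUA; apply: unplayed_legal_move legX len.
Qed.

(** * Closed neighborhoods and packings *)

Definition closed_nbhd (v : G) : {set G} := [set u | (u == v) || adj u v].

Lemma not_dominating D (v : G) : [disjoint closed_nbhd v & D] -> ~~ dominating D.
Proof.
move=> dis; apply/negP => /forallP/(_ v)/exists_inP[u uD uv].
by have := disjointFl dis uD; rewrite inE uv.
Qed.

Lemma card_closed_nbhd (v : G) : #|closed_nbhd v| = (degree v).+1.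
Proof.
have -> : closed_nbhd v = v |: [set u | adj v u].
  by apply/setP => u; rewrite !inE adj_sym.
by rewrite cardsU1 inE adj_irr.
Qed.

Lemma degree_le_max (v : G) : degree v <= max_degree G.
Proof. exact: leq_bigmax. Qed.

Definition nbhd_packing (B : {set G}) : Prop :=
  forall u v w, u \in B -> v \in B ->
    w \in closed_nbhd u -> w \in closed_nbhd v -> u = v.

Lemma nbhd_packingS (A B : {set G}) :
  A \subset B -> nbhd_packing B -> nbhd_packing A.
Proof. by move=> /subsetP sAB packB u v w /sAB uB /sAB vB; apply: packB. Qed.

(** This is the ball of radius 2: [v], and for each of its at most [d] neighbors [w], the vertex [w]
    with its at most [d - 1] neighbors other than [v], where [d] is the maximum degree. *)
Lemma card_second_nbhd (v : G) :
  #|[set u | ~~ [disjoint closed_nbhd u & closed_nbhd v]]| <= max_degree G ^ 2 + 1.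
Proof.
set d := max_degree G.
pose F (w : G) := w |: [set u | adj w u] :\ v.
apply: (@leq_trans #|v |: \bigcup_(w in [set w | adj v w]) F w|).
  apply/subset_leq_card/subsetP => u; rewrite inE => /pred0Pn[w /=].
  rewrite !inE => /andP[uw wv].
  have [//|nuv /=] := eqVneq u v.
  apply/bigcupP; case/orP: wv => [/eqP ewv|wv].
    (* The common vertex is [v], so [u] is itself a neighbor of [v] and lies in [F u]. *)
    exists u; last by rewrite /F !inE eqxx.
    by move: uw; rewrite inE ewv eq_sym (negPf nuv).
  exists w; first by rewrite inE adj_sym.
  by rewrite /F !inE nuv /= eq_sym; case/orP: uw => ->; rewrite ?orbT.
rewrite cardsU1 addnC leq_add ?leq_b1 //.
apply: leq_trans (leq_card_bigcup _ _) _.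
apply: (@leq_trans (\sum_(w in [set w | adj v w]) d)).
  apply: leq_sum => w; rewrite inE => vw.
  rewrite /F cardsU1 !inE adj_irr andbF add1n.
  apply: leq_trans (degree_le_max w).
  by rewrite /degree [X in _ <= X](cardsD1 v) inE adj_sym vw.
by rewrite sum_nat_const -mulnn leq_mul2r degree_le_max orbT.
Qed.

(** Greedy choice: each chosen center rules out only its ball of radius 2. *)
Lemma exists_nbhd_packing (A : {set G}) m :
  m * (max_degree G ^ 2 + 1) <= #|A| ->
  exists B : {set G}, [/\ B \subset A, nbhd_packing B & m <= #|B|].
Proof.
elim: m A => [|m IHm] A leA.
  by exists set0; rewrite sub0set; split=> // u v w; rewrite inE.
have /card_gt0P[v vA] : 0 < #|A| by apply: leq_trans leA; rewrite mulSn addn1.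
set N := [set u | ~~ [disjoint closed_nbhd u & closed_nbhd v]].
have [|B [sBA packB cB]] := IHm (A :\: N).
  have := card_second_nbhd v; rewrite -/N; have := cardsID N A.
  have := subset_leq_card (subsetIr A N); rewrite mulSn in leA; lia.
have vv : v \in closed_nbhd v by rewrite inE eqxx.
have farB u : u \in B -> [disjoint closed_nbhd u & closed_nbhd v].
  by move/(subsetP sBA); rewrite !inE negbK => /andP[].
exists (v |: B); split.
- by rewrite subUset sub1set vA (subset_trans sBA) ?subsetDl.
- move=> x y w; rewrite !in_setU1 => /predU1P[->|xB] /predU1P[->|yB] //.
  + by move=> wv wy; rewrite (disjointFr (farB y yB) wy) in wv.
  + by move=> wx wv; rewrite (disjointFr (farB x xB) wx) in wv.
  + exact: packB.
- rewrite cardsU1; case: (boolP (v \in B)) => [/farB d|//].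
  by have := disjointFr d vv; rewrite vv.
Qed.

(** Each box that meets [X] contains a vertex of [X], and disjoint boxes get distinct ones. *)
Lemma card_hit_packing (B X : {set G}) : nbhd_packing B ->
  #|[set c in B | ~~ [disjoint closed_nbhd c & X]]| <= #|X|.
Proof.
move=> packB; set H := [set _ in _ | _].
have H_hit c : exists w, c \in H -> (w \in closed_nbhd c) && (w \in X).
  case: (boolP (c \in H)) => [|_]; last by exists c.
  by rewrite inE => /andP[_ /pred0Pn[w ?]]; exists w.
have [f fP] := fin_all_exists H_hit.
rewrite -(@card_in_imset _ _ f) => [|c d cH dH efcd].
  apply/subset_leq_card/subsetP => _ /imsetP[c /fP/andP[_ ?] ->] //.
have [/andP[wc _] /andP[wd _]] := (fP c cH, fP d dH).
move: cH dH; rewrite !inE => /andP[cB _] /andP[dB _].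
by apply: (packB c d (f c)) => //; rewrite efcd.
Qed.

End Game.

(** * Staller's box game on a packing *)

(* B is the set of boxes and Q the part of it that is one step ahead.  A box of Q
   weighs k and any other box weighs 1; m is the weight that Dominator can still
   destroy before Staller's next move. *)
Definition box_state (G : sgraph) (k m : nat) (D S : {set G}) : Prop :=
  exists r (B Q : {set G}),
    [/\ k <= r, Q \subset B & nbhd_packing B] /\
    [/\ forall c, c \in B -> [disjoint closed_nbhd c & D],
        forall c, c \in B -> #|closed_nbhd c :\: S| <= r.+1,
        forall c, c \in Q -> #|closed_nbhd c :\: S| <= r &
        k ^ (r.+1 - k) + m <= #|B| + k.-1 * #|Q|].

Definition claimed_nbhd (G : sgraph) (D S : {set G}) : Prop :=
  exists2 c, [disjoint closed_nbhd c & D] & closed_nbhd c \subset S.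

(** Dominator plays at most [k - 1] vertices, each spoiling at most one box of weight at most [k]:
    hence the reserve [k * k.-1] on his turn. *)
Definition staller_inv (G : sgraph) k p (D S : {set G}) : Prop :=
  claimed_nbhd D S \/
  box_state k (if p is Dominator then k * k.-1 else 0) D S.

Lemma disjoint_unplayed (G : sgraph) (A D S : {set G}) :
  [disjoint A & D] -> A :\: S \subset ~: (D :|: S).
Proof.
move=> dis; apply/subsetP => u; rewrite !inE => /andP[/negPf-> uA].
by rewrite orbF (disjointFr dis).
Qed.

(** If at least [k] boxes lie outside [Q], moving [k] of them into [Q] gains exactly the reserve
    [k * k.-1]. Otherwise the level [r] is lowered, or at [r = k] a box is completed. *)
Lemma staller_inv_reply (G : sgraph) k (D S : {set G}) :
  0 < k -> staller_inv k Staller D S ->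
  exists2 X, legal_move k (D :|: S) X & staller_inv k Dominator D (S :|: X).
Proof.
move=> k0 [[c dc sc]|].
  have [X legX] := exists_legal_move k (D :|: S).
  by exists X => //; left; exists c; rewrite ?(subset_trans sc) ?subsetUl.
case=> r; elim: r => [|r IHr] [B [Q [[kr sQB packB] [dB cB cQ]]]];
  rewrite addn0 => wBQ; first lia.
have cBQ : #|B| = #|Q| + #|B :\: Q|.
  by rewrite cardsD (setIidPr sQB) subnKC ?subset_leq_card.
have [leq|ltk] := leqP k #|B :\: Q|.
  (* A full box settles the game; otherwise every box has an unplayed vertex, since Dominator owns
     none of its vertices. *)
  case: (boolP [exists c in B, closed_nbhd c \subset S]) => [/exists_inP[c cinB sc]|].
    have [X legX] := exists_legal_move k (D :|: S).
    exists X => //; left; exists c; rewrite ?(subset_trans sc) ?subsetUl //.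
    exact: dB.
  rewrite negb_exists_in => /forall_inP opB.
  have [|Y [_ sY cY]] := @exists_superset_card _ set0 (B :\: Q) k (sub0set _).
    by rewrite cards0.
  have [||X0 [sX0 cX0 hX0]] := @exists_small_bigcup G G Y (~: (D :|: S))
      (fun c X => ~~ [disjoint closed_nbhd c :\: S & X]).
  - move=> c X Z sXZ; apply: contra => /disjointWr; exact.
  - move=> c cY'; have cinB : c \in B.
      by have := subsetP sY c cY'; rewrite inE => /andP[].
    have /subsetPn[w wc wS] := opB c cinB.
    have wcS : w \in closed_nbhd c :\: S by rewrite in_setD wS wc.
    exists [set w]; rewrite cards1 sub1set; split=> //.
      by apply: (subsetP (disjoint_unplayed S (dB c cinB))).
    by apply/pred0Pn; exists w; rewrite /= wcS inE eqxx.
  have [|X legX sX] := legal_move_extend sX0 (c := k); first by rewrite -cY.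
  exists X => //; right; exists r.+1, B, (Q :|: Y); split; first split=> //.
    by rewrite subUset sQB (subset_trans sY) ?subsetDl.
  have shrink c : closed_nbhd c :\: (S :|: X) \subset closed_nbhd c :\: S.
    by rewrite setDS ?subsetUl.
  split=> // [c cinB|c|].
  - exact: leq_trans (subset_leq_card (shrink c)) (cB c cinB).
  - rewrite in_setU => /orP[cinQ|cinY].
      exact: leq_trans (subset_leq_card (shrink c)) (cQ c cinQ).
    have cinB : c \in B by have := subsetP sY c cinY; rewrite inE => /andP[].
    rewrite -ltnS; apply: leq_trans (cB c cinB).
    have /pred0Pn[w /andP[/= wc wX]] := hX0 c cinY.
    apply: proper_card; rewrite properE shrink.
    apply/subsetPn; exists w => //.
    by rewrite !inE (subsetP sX _ wX) orbT.
  - rewrite cardsU cY (_ : Q :&: Y = set0) ?cards0; last first.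
      apply/setP => c; rewrite !inE; apply/negP => /andP[cinQ /(subsetP sY)].
      by rewrite inE cinQ.
    rewrite subn0 mulnDr [k.-1 * k]mulnC addnA; lia.
(* Fewer than k boxes lag behind; as k divides k ^ (r.+2 - k), they can be dropped. *)
have cQr : k ^ (r.+1 - k) <= #|Q|.
  have := wBQ; rewrite cBQ subSn // expnS => w.
  have : k * k ^ (r.+1 - k) < k * #|Q|.+1.
    case: k k0 {kr IHr wBQ} ltk w => // k _ /=; rewrite mulnS; lia.
  by rewrite ltn_mul2l k0 ltnS.
(* [Q] becomes the whole family one level lower, with no box ahead. *)
have [ltkr|] := leqP k r.
  apply: IHr; exists Q, set0; split.
    by split; rewrite ?sub0set //; exact: nbhd_packingS packB.
  split=> // [c /(subsetP sQB)/dB//|c|]; first by rewrite inE.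
  by rewrite cards0 muln0 !addn0.
(* At level [r.+1 = k] a box of [Q] misses at most [k] vertices, so one move fills it. *)
move=> ltrk; have erk : r.+1 = k by lia.
have /card_gt0P[c cinQ] : 0 < #|Q| by apply: leq_trans cQr; rewrite expn_gt0 k0.
have dc := dB c (subsetP sQB c cinQ).
have [|X legX sX] := legal_move_extend (disjoint_unplayed S dc) (c := k).
  by rewrite -erk cQ.
exists X => //; left; exists c => //.
by rewrite -subDset.
Qed.

(** The at most [k - 1] boxes met by [X] are discarded; each takes away weight at most [k], which
    the reserve covers. *)
Lemma staller_inv_step (G : sgraph) k (D S X : {set G}) :
  staller_inv k Dominator D S -> X \subset ~: (D :|: S) -> #|X| < k ->
  staller_inv k Staller (D :|: X) S.
Proof.
move=> inv sX cX.
case: inv => [[c dc sc]|[r [B [Q [[kr sQB packB] [dB cB cQ wBQ]]]]]].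
  left; exists c => //.
  rewrite disjoints_subset setCU subsetI -disjoints_subset dc (subset_trans sc) //.
  apply/subsetP => u uS; rewrite inE; apply/negP => /(subsetP sX).
  by rewrite !inE uS orbT.
right; set H := [set c in B | ~~ [disjoint closed_nbhd c & X]].
have cH : #|H| <= #|X| := card_hit_packing X packB.
exists r, (B :\: H), (Q :\: H).
split; first by split; rewrite ?setSD //; apply: nbhd_packingS packB; apply: subsetDl.
split=> [c|c|c|].
- rewrite !inE => /andP[+ cinB]; rewrite cinB negbK => cX'.
  by rewrite disjoints_subset setCU subsetI -!disjoints_subset dB.
- by rewrite inE => /andP[_]; apply: cB.
- by rewrite inE => /andP[_]; apply: cQ.
- rewrite addn0.
  have hB : #|B| <= #|B :\: H| + #|H|.
    by rewrite -(cardsID H B) addnC leq_add2l subset_leq_card ?subsetIr.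
  have hQ : #|Q| <= #|Q :\: H| + #|H|.
    by rewrite -(cardsID H Q) addnC leq_add2l subset_leq_card ?subsetIr.
  have hk : #|H| <= k.-1 by lia.
  case: k {kr} cX wBQ hk => // k _ /= wBQ hk.
  have := leq_mul (leqnn k.+1) hk; have := leq_mul (leqnn k) hQ.
  rewrite mulnDr mulSn; lia.
Qed.

Lemma packing_staller_wins (G : sgraph) a k (B D : {set G}) n :
  0 < a < k -> k <= max_degree G -> nbhd_packing B ->
  (forall c, c \in B -> [disjoint closed_nbhd c & D]) ->
  k ^ (max_degree G - k + 1) <= #|B| -> #|~: D| <= n ->
  winner a k n Staller D set0 = Staller.
Proof.
move=> /andP[a0 ak] kD packB dB cB cD.
have k0 : 0 < k by lia.
apply: (@staller_strategy G a k (staller_inv k)) => //.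
- by move=> D' S; apply: staller_inv_reply.
- move=> D' S X inv legX; apply: staller_inv_step => //.
    by case/andP: legX.
  exact: leq_ltn_trans (card_legal_move legX) ak.
- move=> p D' S [[c dc _] _|]; first exact: not_dominating dc.
  case=> r [B' [Q [[kr sQB _] [dB' _ _ w]]]] _.
  (* The weight is at least a positive power of [k], so some box survives. *)
  have /card_gt0P[c cB'] : 0 < #|B'|.
    rewrite lt0n; apply/negP => /eqP c0; move: w.
    have := subset_leq_card sQB; rewrite c0 leqn0 => /eqP->; rewrite muln0.
    have : 0 < k ^ (r.+1 - k) by rewrite expn_gt0 k0.
    lia.
  exact: not_dominating (dB' c cB').
(* A closed neighborhood has at most [(max_degree G).+1] vertices, which fixes the initial level. *)
- right; exists (max_degree G), B, set0; split; first by split=> //; apply: sub0set.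
  split=> // [c _|c|].
  + by rewrite setD0 card_closed_nbhd ltnS degree_le_max.
  + by rewrite inE.
  + by rewrite subSn // -addn1 cards0 muln0 !addn0.
- by rewrite setU0.
Qed.

Lemma staller_wins_S_game (G : sgraph) a k :
  0 < a < k -> k <= max_degree G ->
  k ^ (max_degree G - k + 1) * (max_degree G ^ 2 + 1) <= #|G| ->
  W' G a k = Staller.
Proof.
move=> ak kD; rewrite -cardsT => /exists_nbhd_packing[B [_ packB cB]].
apply: packing_staller_wins packB _ cB _ => //.
- by move=> c _; rewrite disjoints_subset setC0 subsetT.
- exact: max_card.
Qed.

(** With [d] the maximum degree, Dominator's first move has at most [d - 1] vertices and meets at
    most [(d - 1) * (d + 1)] closed neighborhoods. The additional [d ^ 2 + 1] vertices of the bound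
    absorb this loss. *)
Lemma staller_wins_D_game (G : sgraph) a k :
  0 < a < k -> k <= max_degree G ->
  (k ^ (max_degree G - k + 1) + 1) * (max_degree G ^ 2 + 1) <= #|G| ->
  W G a k = Staller.
Proof.
move=> ak kD cG; rewrite /W; have [n eG] : {n | #|G| = n.+1}.
  by exists #|G|.-1; rewrite prednK //; apply: leq_trans cG; rewrite muln_gt0 !addn1.
rewrite eG /=; case: existsP => // -[X /andP[legX]].
have a0 : 0 < a by lia.
rewrite set0U; suff -> : winner a k n Staller X set0 = Staller by [].
set A := [set c | [disjoint closed_nbhd c & X]].
have cA : #|~: A| <= max_degree G ^ 2 + 1.
  apply: (@leq_trans (#|X| * (max_degree G).+1)).
    apply: (@leq_trans #|\bigcup_(w in X) closed_nbhd w|).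
      apply/subset_leq_card/subsetP => c; rewrite !inE => /pred0Pn[w /andP[/= wc wX]].
      apply/bigcupP; exists w => //; move: wc; rewrite !inE adj_sym => /orP[/eqP->|->].
        by rewrite eqxx.
      by rewrite orbT.
    apply: leq_trans (leq_card_bigcup _ _) _.
    rewrite -sum_nat_const; apply: leq_sum => w _.
    by rewrite card_closed_nbhd ltnS degree_le_max.
  have := card_legal_move legX; move: kD ak; rewrite -mulnn; nia.
have [|B [sBA packB cB]] := @exists_nbhd_packing G A (k ^ (max_degree G - k + 1)).
  have := cardsC A; rewrite mulnDl mul1n in cG; lia.
apply: packing_staller_wins packB _ cB _ => // [c /(subsetP sBA)|].
  by rewrite inE.
have := unplayed_legal_move (n := n) a0 legX; rewrite setU0 set0U; apply.
by rewrite setC0 cardsT eG.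
Qed.

(** * Balanced orientations *)

Definition orients (V E : finType) (ends : E -> {set V}) (o : {ffun E -> V}) :=
  [forall e, o e \in ends e].

Definition outdeg (V E : finType) (o : {ffun E -> V}) (x : V) : nat :=
  #|[set e | o e == x]|.

Definition arc (V E : finType) (ends : E -> {set V}) (o : {ffun E -> V}) : rel V :=
  fun y z => [exists e, (o e == y) && (z \in ends e)].

(** With [o e] read as the tail of [e], reversing the edges of a path transfers one unit of
    outdegree from its start to its end. The additive form avoids truncated subtraction. *)
Lemma reverse_path (V E : finType) (ends : E -> {set V}) (p : seq V) y
    (o : {ffun E -> V}) :
  orients ends o -> path (arc ends o) y p -> uniq (y :: p) ->
  exists2 o', orients ends o' &
    forall w, outdeg o' w + (w == y) = outdeg o w + (w == last y p).
Proof.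
elim: p y o => [|z p IHp] y o oriO; first by move=> _ _; exists o.
move=> /= /andP[/existsP[e /andP[/eqP oe ze]] pathp] /and3P[ynzp znp uniqp].
pose o1 : {ffun E -> V} := [ffun f => if f == e then z else o f].
have nyz : (y == z) = false by move: ynzp; rewrite inE negb_or => /andP[/negPf].
have out1 w : outdeg o1 w + (w == y) = outdeg o w + (w == z).
  rewrite /outdeg (cardsD1 e) [X in _ = X + _](cardsD1 e) !inE ffunE eqxx oe.
  have -> : [set f | o1 f == w] :\ e = [set f | o f == w] :\ e.
    by apply/setP => f; rewrite !inE ffunE; case: (f == e).
  rewrite ![_ == w]eq_sym; lia.
have [|||o' oriO' outO'] := IHp z o1.
- apply/forallP => f; rewrite ffunE; case: eqP => [->|_] //.
  exact: (forallP oriO).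
(* The rest of the path does not use [e]: such an arc would start at [y], against [uniq]. *)
- apply: sub_in_path pathp; last exact: (introT allP (fun u h => h)).
  move=> u v uzp _ /existsP[f /andP[/eqP of_ vf]].
  apply/existsP; exists f; rewrite ffunE vf andbT; case: (eqVneq f e) => [efe|_].
    by move: ynzp; rewrite -oe -efe of_ uzp.
  by rewrite of_.
- by rewrite /= znp.
exists o' => // w; have := outO' w; have := out1 w; lia.
Qed.

(** Count by edges: an edge meeting [R] has its tail in [R], so it counts at most twice on the left
    and exactly twice on the right. *)
Lemma outdeg_sum (V E : finType) (ends : E -> {set V}) (o : {ffun E -> V})
    (R : {set V}) :
  (forall e, #|ends e| = 2) ->
  (forall e y, y \in ends e -> y \in R -> o e \in R) ->
  \sum_(y in R) #|[set e | y \in ends e]| <= 2 * \sum_(y in R) outdeg o y.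
Proof.
move=> ends2 closedR.
have cardE (P : pred E) : #|[set e | P e]| = \sum_e P e.
  by rewrite -sum1dep_card big_mkcond; apply: eq_bigr => e _; case: (P e).
rewrite /outdeg; under eq_bigr do rewrite cardE.
under [X in _ <= 2 * X]eq_bigr do rewrite cardE.
rewrite exchange_big [X in _ <= 2 * X]exchange_big big_distrr /=.
apply: leq_sum => e _; case: (boolP (o e \in R)) => [oeR|oeR].
  rewrite [X in _ <= 2 * X](bigD1 (o e)) //= eqxx mulnDr muln1.
  apply: leq_trans (leq_addr _ _); rewrite -(ends2 e) -sum1_card.
  rewrite big_mkcond [leqRHS]big_mkcond /=; apply: leq_sum => y _.
  by case: (y \in R); case: (y \in ends e).
rewrite big1 // => y yR; case: (boolP (y \in ends e)) => // ye.
by rewrite (closedR e y) in oeR.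
Qed.

(** Minimize the total deficiency. A vertex [x] below [t] could gain a unit from any [y] above [t]
    that reaches it; if there is none, the set [R] of vertices reaching [x] has too few outgoing
    edges for its degrees. *)
Lemma balanced_orientation (V E : finType) (ends : E -> {set V}) t :
  (forall e, #|ends e| = 2) ->
  (forall x, 2 * t <= #|[set e | x \in ends e]|) ->
  exists2 o : {ffun E -> V}, forall e, o e \in ends e &
    forall x, t <= outdeg o x.
Proof.
move=> ends2 degE.
have [o0 oriO0] : exists o : {ffun E -> V}, orients ends o.
  have [|f fP] := @fin_all_exists E (fun=> V) (fun e y => y \in ends e).
    by move=> e; apply/card_gt0P; rewrite ends2.
  by exists [ffun e => f e]; apply/forallP => e; rewrite ffunE.
pose deficiency (o : {ffun E -> V}) := \sum_x (t - outdeg o x).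
case: (arg_minnP deficiency oriO0) => o oriO minO.
exists o; first exact/forallP.
move=> x; rewrite leqNgt; apply/negP => ltx.
pose R := [set y | connect (arc ends o) y x].
have xR : x \in R by rewrite inE connect0.
have [|] := boolP [exists y in R, t < outdeg o y]; last first.
  rewrite negb_exists_in => /forall_inP leR.
  have closedR e y : y \in ends e -> y \in R -> o e \in R.
    move=> ye; rewrite !inE; apply: connect_trans; apply: connect1.
    by apply/existsP; exists e; rewrite eqxx.
  have := outdeg_sum ends2 closedR.
  have -> : \sum_(y in R) outdeg o y = \sum_(y in R | y != x) outdeg o y + outdeg o x.
    by rewrite (bigD1 x) // addnC.
  have : \sum_(y in R) 2 * t <= \sum_(y in R) #|[set e | y \in ends e]|.
    by apply: leq_sum => y _.
  have : \sum_(y in R | y != x) outdeg o y <= \sum_(y in R | y != x) t.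
    by apply: leq_sum => y /andP[/leR]; rewrite -leqNgt.
  have -> : \sum_(y in R) 2 * t = 2 * (\sum_(y in R | y != x) t + t).
    by rewrite -big_distrr /= [in LHS](bigD1 x) //= addnC.
  lia.
case/exists_inP=> y; rewrite inE => /connectP[p0 /shortenP[p pathp uniqp _] ex ty].
have [o' oriO' outO'] := reverse_path oriO pathp uniqp.
have := minO o' oriO'; apply/negP; rewrite -ltnNge.
have nyx : x != y by apply/eqP => exy; move: ty; rewrite -exy; lia.
(* [x] gains a unit and [y] stays at [t] or above, so only the term of [x] changes, and it drops. *)
rewrite /deficiency (bigD1 x) // [ltnRHS](bigD1 x) //=.
rewrite -addSn; apply: leq_add.
  have := outO' x; rewrite -ex eqxx (negPf nyx); lia.
apply: leq_sum => w nwx; have := outO' w; rewrite -ex (negPf nwx).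
by case: (eqVneq w y) => [->|_]; lia.
Qed.

(** * Degrees in the line graph *)

Definition ends (H : sgraph) (e : line_graph H) : {set H} :=
  val (e : line_vertex H).

Lemma card_ends (H : sgraph) (e : line_graph H) : #|ends e| = 2.
Proof.
have := valP (e : line_vertex H); rewrite inE.
case/existsP=> x /existsP[y /andP[xy /eqP eE]].
rewrite /ends eE cards2; case: eqVneq xy => // ->.
by rewrite adj_irr.
Qed.

Lemma degree_le_incident (H : sgraph) (x : H) :
  degree x <= #|[set e : line_graph H | x \in ends e]|.
Proof.
rewrite -(card_imset _ (val_inj : injective (fun e : line_vertex H => val e))).
rewrite /degree -(@card_in_imset _ _ (fun u => [set x; u])) => [|u v].
  apply/subset_leq_card/subsetP => _ /imsetP[u xu ->]; rewrite inE in xu.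
  have edge_xu : [set x; u] \in edge_set H.
    by rewrite inE; apply/existsP; exists x; apply/existsP; exists u; rewrite xu eqxx.
  apply/imsetP; exists (exist (fun A => A \in edge_set H) _ edge_xu) => //.
  by rewrite inE /ends /= set21.
rewrite !inE => xu xv /setP/(_ u); rewrite !inE eqxx orbT.
by case: eqVneq xu => [->|_ _ /=]; rewrite ?adj_irr // => /esym/eqP.
Qed.

Lemma min_degree_le (H : sgraph) (x : H) : min_degree H <= degree x.
Proof.
rewrite /min_degree; elim: index_enum (mem_index_enum x) => // y s IHs.
rewrite inE big_cons geq_min => /predU1P[->|/IHs->]; first by rewrite leqnn.
by rewrite orbT.
Qed.

(** The edges at [x] are pairwise adjacent, so they all lie in the closed neighborhood of [e]. *)
Lemma degree_line_graph (H : sgraph) (e : line_graph H) (x : H) :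
  x \in ends e -> degree x <= (degree e).+1.
Proof.
move=> xe; apply: leq_trans (degree_le_incident x) _.
rewrite -card_closed_nbhd; apply/subset_leq_card/subsetP => f.
rewrite !inE => xf; case: eqVneq => //= nfe.
by apply/andP; split=> //; apply/set0Pn; exists x; rewrite inE; apply/andP.
Qed.

(** * Dominator's answers along the orientation *)

Definition hit (H : sgraph) (D : {set line_graph H}) (x : H) : Prop :=
  exists2 e, e \in D & x \in ends e.

(** Such an [x] is lost, yet every edge at it is dominated through its other end. *)
Definition isolated (H : sgraph) (D S : {set line_graph H}) (x : H) : Prop :=
  forall e, x \in ends e ->
    e \in S /\ forall y, y \in ends e -> y != x -> hit D y.

Definition safe (H : sgraph) (o : line_graph H -> H)
    (D S : {set line_graph H}) : Prop :=
  forall x, [\/ hit D x, forall e, o e = x -> e \notin S | isolated D S x].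

(** Staller's last move [X] may break safety, so on Dominator's turn it is recorded apart from the
    earlier [S0]. *)
Definition dominator_inv (H : sgraph) (o : line_graph H -> H) (b : nat) p
    (D S : {set line_graph H}) : Prop :=
  if p is Staller then safe o D S
  else exists S0 X, [/\ S = S0 :|: X, X \subset ~: (D :|: S0), #|X| <= b
                      & safe o D S0].

Lemma hitS (H : sgraph) (D D' : {set line_graph H}) (x : H) :
  D \subset D' -> hit D x -> hit D' x.
Proof. by move=> /subsetP sDD' [e /sDD' eD xe]; exists e. Qed.

Definition answered (H : sgraph) (o : line_graph H -> H)
    (S D : {set line_graph H}) (e : line_graph H) : Prop :=
  hit D (o e) \/
  (forall f, o e \in ends f -> f \in S) /\
  (forall y, y \in ends e -> y != o e -> hit D y).

Lemma answeredS (H : sgraph) (o : line_graph H -> H)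
    (S D D' : {set line_graph H}) (e : line_graph H) :
  D \subset D' -> answered o S D e -> answered o S D' e.
Proof.
move=> sDD' [hx|[inS hity]]; [left|right]; first exact: hitS hx.
by split=> // y ye nyx; apply: hitS (hity y ye nyx).
Qed.

Lemma exists_answer (H : sgraph) (o : {ffun line_graph H -> H}) t
    (D S0 X : {set line_graph H}) e :
  (forall e, o e \in ends e) -> (forall x, t <= outdeg o x) ->
  X \subset ~: (D :|: S0) -> #|X| < 2 * t -> safe o D S0 -> e \in X ->
  exists R : {set line_graph H},
    [/\ R \subset ~: (D :|: (S0 :|: X)), #|R| <= 1 &
        answered o (S0 :|: X) (D :|: R) e].
Proof.
move=> oE outo sX cX safeD eX; set U := ~: (D :|: (S0 :|: X)).
have : e \in ~: (D :|: S0) by apply: (subsetP sX).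
rewrite in_setC in_setU negb_or => /andP[eD eS0].
have reply x f : f \in U -> x \in ends f ->
    exists R : {set line_graph H}, [/\ R \subset U, #|R| <= 1 & hit (D :|: R) x].
  move=> fU xf; exists [set f]; rewrite sub1set cards1; split=> //.
  by exists f; rewrite // !inE eqxx orbT.
(* [e] was free before [X], so its end [x] is not [isolated]; if also unhit, its outgoing edges were
   all free then. *)
have fresh x : ~ hit D x -> x \in ends e -> forall f, o f = x -> f \notin D :|: S0.
  move=> nhit xe f ofx; rewrite in_setU negb_or; apply/andP; split.
    by apply/negP => fD; apply: nhit; exists f => //; rewrite -ofx.
  case: (safeD x) => [//|-> //|/(_ e xe)[]]; by rewrite (negPf eS0).
have [hx|nhx] := boolp.pselect (hit D (o e)).
  by exists set0; rewrite sub0set cards0 setU0; split=> //; left.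
have [/exists_inP[f fU xf]|] := boolP [exists f in U, o e \in ends f].
  by have [R [sR cR hR]] := reply _ f fU xf; exists R; split=> //; left.
rewrite negb_exists_in => /forall_inP noU.
have inS f : o e \in ends f -> f \in S0 :|: X.
  move=> xf; apply/negPn/negP => fS; suff /noU/negP : f \in U by [].
  rewrite in_setC in_setU (negPf fS) orbF; apply/negP => fD.
  by apply: nhx; exists f.
(* Edges leaving [o e] now belong to Staller but were free before [X], so they were all taken in
   this move. *)
have outX : [set f | o f == o e] \subset X.
  apply/subsetP => f; rewrite inE => /eqP ofx.
  have := fresh _ nhx (oE e) f ofx; have := inS f; rewrite -ofx oE => /(_ isT).
  by rewrite !in_setU negb_or => /orP[->|->//]; rewrite andbF.
have /card_gt0P[y] : 0 < #|ends e :\ o e|.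
  by have := cardsD1 (o e) (ends e); rewrite card_ends oE; lia.
rewrite in_setD1 => /andP[nyx ye].
have only_y z : z \in ends e -> z != o e -> z = y.
  move=> ze nzx; have : #|ends e :\ o e| <= 1.
    by have := cardsD1 (o e) (ends e); rewrite card_ends oE; lia.
  by move/card_le1_eqP; apply; rewrite in_setD1 ?nzx ?nyx.
have [hy|nhy] := boolp.pselect (hit D y).
  exists set0; rewrite sub0set cards0 setU0; split=> //; right; split=> // z ze nzx.
  by rewrite (only_y z).
(* If [X] also contained all edges leaving [y], it would have at least [2 * t] elements. *)
have /subsetPn[f] : ~~ ([set f | o f == y] \subset X).
  apply/negP => outyX; move: cX; rewrite ltnNge => /negP; apply.
  have := subset_leq_card (_ : [set f | o f == o e] :|: [set f | o f == y] \subset X).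
  rewrite subUset outX outyX cardsU => /(_ isT); apply: leq_trans.
  rewrite (_ : _ :&: _ = set0) ?cards0; last first.
    by apply/setP => f; rewrite !inE; case: eqP => //= ->; rewrite eq_sym (negPf nyx).
  by rewrite subn0 mul2n -addnn; apply: leq_add; apply: outo.
rewrite inE => /eqP ofy fX.
have fU : f \in U.
  by rewrite in_setC setUA in_setU (negPf fX) orbF; apply: fresh ofy.
have yf : y \in ends f by rewrite -ofy.
have [R [sR cR hR]] := reply y f fU yf; exists R; split=> //; right; split=> // z ze nzx.
by rewrite (only_y z).
Qed.

(** The delicate case is an unhit [x] that loses its first outgoing edges in [X]: the answers give
    all its edges to Staller, and [x] becomes [isolated]. *)
Lemma safe_answered (H : sgraph) (o : line_graph H -> H)
    (D D' S0 X : {set line_graph H}) :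
  (forall e, o e \in ends e) -> D \subset D' -> safe o D S0 ->
  (forall e, e \in X -> answered o (S0 :|: X) D' e) -> safe o D' (S0 :|: X).
Proof.
move=> oE sDD' safeD ans x.
have [hx|nhx] := boolp.pselect (hit D' x); first by constructor 1.
case: (safeD x) => [hx|freshx|isox].
- by constructor 1; apply: hitS hx.
- have [/exists_inP[e eX /eqP oex]|] := boolP [exists e in X, o e == x]; last first.
    rewrite negb_exists_in => /forall_inP noX; constructor 2 => e oex.
    rewrite in_setU negb_or freshx //=; apply/negP => /noX; by rewrite oex eqxx.
  constructor 3; have := ans e eX; rewrite /answered oex => -[//|[inS _]] f xf.
  split=> [|y yf nyx]; first exact: inS.
  (* An edge leaving [x] was not in [S0], so it is in [X] and its own answer hits the other end. *)
  have [ofx|nofx] := eqVneq (o f) x.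
    have := inS f xf; rewrite in_setU (negPf (freshx f ofx)) /= => /ans.
    rewrite /answered ofx.
    by case=> [//|[_]]; apply.
  have ofy : o f = y.
    have : #|ends f :\ x| <= 1.
      by have := cardsD1 x (ends f); rewrite card_ends xf; lia.
    by move/card_le1_eqP; apply; rewrite in_setD1 ?nofx ?nyx ?oE.
  (* Here [f] leaves [y]. Safety of [y] if [f] is in [S0], or else the answer to [f], makes [y] hit,
     as [x] is unhit. *)
  have := inS f xf; rewrite in_setU => /orP[fS0|/ans].
    case: (safeD y) => [|/(_ f ofy)|/(_ f yf)[_ /(_ x xf)]]; first exact: hitS.
      by rewrite fS0.
    by rewrite eq_sym => /(_ nyx) /(hitS sDD').
  by rewrite /answered ofy => -[//|[_ /(_ x xf)]]; rewrite eq_sym => /(_ nyx).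
- constructor 3 => e /isox[eS0 hity]; rewrite in_setU eS0; split=> // y ye nyx.
  exact: hitS (hity y ye nyx).
Qed.

Lemma dominator_inv_reply (H : sgraph) (o : {ffun line_graph H -> H}) t a b
    (D S : {set line_graph H}) :
  (forall e, o e \in ends e) -> (forall x, t <= outdeg o x) ->
  b <= a -> b < 2 * t -> dominator_inv o b Dominator D S ->
  exists2 X, legal_move a (D :|: S) X & dominator_inv o b Staller (D :|: X) S.
Proof.
move=> oE outo ba bt [S0 [X [-> sX cX safeD]]].
have [||R [sR cR ansR]] := @exists_small_bigcup _ _ X (~: (D :|: (S0 :|: X)))
    (fun e R => answered o (S0 :|: X) (D :|: R) e).
- by move=> e Y Z sYZ; apply/answeredS/setUS.
- by move=> e; apply: exists_answer => //; apply: leq_ltn_trans bt.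
have [|Y legY sRY] := legal_move_extend sR (c := a); first by lia.
exists Y => //=; apply: safe_answered safeD _ => //; first exact: subsetUl.
by move=> e /ansR; apply/answeredS/setUS.
Qed.

(** An edge is dominated once an end is hit. On a full board, outgoing edges that Staller does not
    own are Dominator's, and [0 < t] provides one. *)
Lemma safe_dominating (H : sgraph) (o : {ffun line_graph H -> H}) t
    (D S : {set line_graph H}) :
  0 < t -> (forall e, o e \in ends e) -> (forall x, t <= outdeg o x) ->
  safe o D S -> D :|: S = setT -> dominating D.
Proof.
move=> t0 oE outo safeD full; apply/forallP => e.
have hit_dom x : x \in ends e -> hit D x -> [exists f in D, (f == e) || adj f e].
  move=> xe [f fD xf]; apply/exists_inP; exists f => //.
  case: eqVneq => //= nfe; apply/andP; split=> //.
  by apply/set0Pn; exists x; rewrite inE; apply/andP.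
case: (safeD (o e)) => [/hit_dom|fresh|/(_ e (oE e))[_ hity]]; first exact.
  have /card_gt0P[f] : 0 < outdeg o (o e) by apply: leq_trans (outo _).
  rewrite inE => /eqP ofx; apply: (hit_dom (o e)) => //.
  exists f; last by rewrite -ofx.
  have := in_setT f; rewrite -full in_setU (negPf (fresh f ofx)) orbF //.
have /card_gt0P[y] : 0 < #|ends e :\ o e|.
  by have := cardsD1 (o e) (ends e); rewrite card_ends oE; lia.
by rewrite in_setD1 => /andP[nyx ye]; apply: (hit_dom y) => //; apply: hity.
Qed.

Lemma dominator_wins (H : sgraph) t a b p :
  0 < t -> 2 * t <= min_degree H -> 0 < b <= a -> b < 2 * t ->
  winner a b #|line_graph H| p (set0 : {set line_graph H}) set0 = Dominator.
Proof.
move=> t0 degH /andP[b0 ba] bt.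
have [x|o oE outo] := @balanced_orientation H (line_graph H) (@ends H) t (@card_ends H).
  exact: leq_trans degH (leq_trans (min_degree_le x) (degree_le_incident x)).
have a0 : 0 < a by lia.
have reply D S : dominator_inv o b Dominator D S -> _ :=
  dominator_inv_reply oE outo ba bt.
have safe0 : safe o set0 set0 by move=> x; constructor 2 => e _; rewrite inE.
apply: (@dominator_strategy _ a b (dominator_inv o b)) => //.
- move=> D S X safeD legX; exists S, X; split=> //;
    [by case/andP: legX | exact: card_legal_move legX].
- move=> [] D S; last exact: safe_dominating t0 oE outo.
  (* On a full board the reply is empty, but it turns the invariant into safety for the whole of
     [S]. *)
  move=> /reply[X /andP[sX _] safeX] full.
  suff <- : D :|: X = D.
    by apply: (safe_dominating t0 oE outo safeX); rewrite setUAC full setTU.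
  by apply/setUidPl; move: sX; rewrite full setCT subset0 => /eqP->; apply: sub0set.
- case: p => //=; exists set0, set0; rewrite setU0 sub0set cards0; split=> //.
- exact: max_card.
Qed.

(** * The four thresholds *)

Theorem corollary14 (t : nat) (H : sgraph) :
  0 < t -> 2 * t <= min_degree H ->
  let G := line_graph H in
  let Delta := max_degree G in
  forall k : nat, 2 <= k <= 2 * t - 1 ->
    (k ^ (Delta - k + 1) * (Delta ^ 2 + 1) <= #|G| ->
       a'_thr G k = Some k /\ b'_thr G (k - 1) = Some k) /\
    ((k ^ (Delta - k + 1) + 1) * (Delta ^ 2 + 1) <= #|G| ->
       a_thr G k = Some k /\ b_thr G (k - 1) = Some k).
Proof.
move=> t0 degH G Delta k /andP[k2 kt].
have domW p a b : 0 < b <= a -> b < 2 * t ->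
    winner a b #|G| p (set0 : {set G}) set0 = Dominator.
  exact: (dominator_wins p t0 degH).
(* The edges at an end of [e] form a clique of at least [2 * t] vertices, so [Delta] is at least
   [2 * t - 1]. *)
have kDelta : 0 < #|G| -> k <= Delta.
  case/card_gt0P => e _; have /card_gt0P[x xe] : 0 < #|ends e| by rewrite card_ends.
  have : 2 * t <= Delta.+1.
    apply: leq_trans degH (leq_trans (min_degree_le x) _).
    by apply: leq_trans (degree_line_graph xe) _; rewrite ltnS degree_le_max.
  lia.
have G0 m : 0 < m -> m * (Delta ^ 2 + 1) <= #|G| -> 0 < #|G|.
  by move=> m0; apply: leq_trans; rewrite muln_gt0 m0 addn1.
have pow0 : 0 < k ^ (Delta - k + 1) by rewrite expn_gt0 (ltnW k2).
split=> cG.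
  have stW a : 0 < a < k -> W' G a k = Staller.
    by move=> ak; apply: staller_wins_S_game => //; apply: kDelta; apply: G0 cG.
  (* Dominator wins when his bias is at least Staller's, and Staller with bias [k] beats every
     smaller bias, so both minima are [k]. *)
  split; apply: min_posE; try lia.
  - by rewrite /W' domW //; lia.
  - by move=> i ik; rewrite stW.
  - by rewrite stW //; lia.
  - by move=> i ik; rewrite /W' domW //; lia.
have stW a : 0 < a < k -> W G a k = Staller.
  move=> ak; apply: staller_wins_D_game => //; apply: kDelta; apply: G0 cG.
  by rewrite addn1.
split; apply: min_posE; try lia.
- by rewrite /W domW //; lia.
- by move=> i ik; rewrite stW.
- by rewrite stW //; lia.
- by move=> i ik; rewrite /W domW //; lia.
Qed.
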